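(* Let $n\ge 1$ and let $g_{1,n}, g_{2,n}: [1]\times[2]\times\cdots\times[n]\to S_n$ be the bijections defined in the context. The fixed points of the map $g_{1,n}\circ g_{2,n}^{-1}:S_n\to S_n$ are exactly the involutions of $S_n$.
   Context: Notation: $[m]=\{1,2,\dots,m\}$, and $S_n$ is the set of permutations of $[n]$. A permutation $\sigma$ is identified with its one-line notation, and $\sigma[i]$ is its $i$-th entry from the left, i.e. $\sigma[i]$ is the image of $i$ under $\sigma$. A word is an element $w\in[1]\times[2]\times\cdots\times[n]$; $w[i]$ is its $i$-th letter from the left, so $1\le w[i]\le i$. An involution is a permutation equal to its own inverse (the identity included). Definition of $g_{1,n}$ (recursive): $g_{1,1}(1)=1$. For $n\ge 2$, let $w'$ be the word formed by the first $n-1$ letters of $w$. Then $g_{1,n}(w)$ is the one-line word obtained from the one-line word $g_{1,n-1}(w')$ by inserting $n$ so that it occupies the $w[n]$-th position counting from the left in the resulting word. (Examples for $n=3$: $111\mapsto 321$, $112\mapsto 231$, $121\mapsto 312$.) Definition of $g_{2,n}$: read $w$ backwards, for $i=n,n-1,\dots,1$, starting from the empty one-line word. At step $i$, place at the left end (in front of the entries already placed) the $w[i]$-th smallest element of $[n]$ that has not yet been placed. The resulting one-line word is $g_{2,n}(w)$. (Examples for $n=3$: $111\mapsto 321$, $112\mapsto 312$, $121\mapsto 231$.) Both maps are bijections. *)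

(* Defs.v *)
From mathcomp Require Import all_boot all_fingroup.

Set Implicit Arguments.
Unset Strict Implicit.
Unset Printing Implicit Defensive.

(* Words of [1] x [2] x ... x [n].  Indices and letters are stored from 0:     *)
(* the letter w[i] of the word is (w (i - 1)).+1, so that 1 <= w[i] <= i.      *)
Definition word (n : nat) : finType := {dffun forall i : 'I_n, 'I_i.+1}.

(* The sequences below (letters, one-line words) carry the usual 1-based       *)
(* values; only the carriers 'I_n and 'I_i.+1 are 0-based.                     *)
Definition letters (n : nat) (w : word n) : seq nat :=
  [seq (w i : nat).+1 | i <- enum 'I_n].

Definition oneline (n : nat) (s : 'S_n) : seq nat :=
  [seq (s i : nat).+1 | i <- enum 'I_n].

(* x occupies the k-th position (k >= 1) of the result.                        *)
Definition insert_at (k x : nat) (s : seq nat) : seq nat :=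
  take k.-1 s ++ x :: drop k.-1 s.

(* foldl realizes the recursion on prefixes: see g1_line_rcons.                *)
Definition g1_line (w : seq nat) : seq nat :=
  foldl (fun s k => insert_at k (size s).+1 s) [::] w.

(* The entries of [N] not yet placed, in increasing order.                     *)
Definition free (N : nat) (p : seq nat) : seq nat :=
  [seq x <- iota 1 N | x \notin p].

(* foldr reads w from its last letter to its first one, p being the word of    *)
(* the entries already placed.                                                 *)
Definition g2_place (N : nat) (w : seq nat) : seq nat :=
  foldr (fun k p => nth 0 (free N p) k.-1 :: p) [::] w.

Definition g2_line (w : seq nat) : seq nat := g2_place (size w) w.

Example g1_line_111 : g1_line [:: 1; 1; 1] = [:: 3; 2; 1]. Proof. by []. Qed.
Example g1_line_112 : g1_line [:: 1; 1; 2] = [:: 2; 3; 1]. Proof. by []. Qed.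
Example g1_line_121 : g1_line [:: 1; 2; 1] = [:: 3; 1; 2]. Proof. by []. Qed.
Example g2_line_111 : g2_line [:: 1; 1; 1] = [:: 3; 2; 1]. Proof. by []. Qed.
Example g2_line_112 : g2_line [:: 1; 1; 2] = [:: 3; 1; 2]. Proof. by []. Qed.
Example g2_line_121 : g2_line [:: 1; 2; 1] = [:: 2; 3; 1]. Proof. by []. Qed.

Lemma size_letters n (w : word n) : size (letters w) = n.
Proof. by rewrite size_map size_enum_ord. Qed.

Lemma nth_letters n (w : word n) (i : 'I_n) : nth 0 (letters w) i = (w i).+1.
Proof. by rewrite (nth_map i) ?size_enum_ord // nth_ord_enum. Qed.

Lemma letters_bound n (w : word n) j :
  j < n -> 0 < nth 0 (letters w) j <= j.+1.
Proof. by move=> jn; rewrite -[j]/(val (Ordinal jn)) nth_letters /= ltn_ord. Qed.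

Lemma letters_inj n : injective (@letters n).
Proof.
move=> w w' e; apply/ffunP => i; apply/val_inj/succn_inj.
by rewrite -!nth_letters e.
Qed.

Lemma oneline_inj n : injective (@oneline n).
Proof.
move=> s t /eq_in_map e; apply/permP => i; apply/val_inj/succn_inj.
by apply: e; rewrite mem_enum.
Qed.

Lemma oneline_ex n l :
  perm_eq l (iota 1 n) -> exists s : 'S_n, oneline s == l.
Proof.
move=> pl; have sl : size l = n by rewrite (perm_size pl) size_iota.
have ul : uniq l by rewrite (perm_uniq pl) iota_uniq.
have bl (i : 'I_n) : 0 < nth 0 l i <= n.
  have : nth 0 l i \in l by rewrite mem_nth // sl.
  by rewrite (perm_mem pl) mem_iota add1n ltnS.
have bl' (i : 'I_n) : (nth 0 l i).-1 < n.
  by case/andP: (bl i) => p; rewrite prednK.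
pose f i : 'I_n := Ordinal (bl' i).
have fE i : (f i : nat).+1 = nth 0 l i.
  by rewrite /= prednK //; case/andP: (bl i).
have f_inj : injective f.
  move=> i j e; apply/val_inj/eqP.
  rewrite -(@nth_uniq _ 0 l i j) ?sl ?ltn_ord //; apply/eqP.
  exact: etrans (esym (fE i)) (etrans (congr1 (fun k : 'I_n => k.+1) e) (fE j)).
exists (perm f_inj); apply/eqP; apply: (@eq_from_nth _ 0).
  by rewrite size_map size_enum_ord.
rewrite size_map size_enum_ord => i ltin.
rewrite (nth_map (Ordinal ltin)) ?size_enum_ord //.
by rewrite -[i]/(val (Ordinal ltin)) nth_ord_enum permE fE.
Qed.

Lemma g1_line_rcons w k :
  g1_line (rcons w k) = insert_at k (size w).+1 (g1_line w).
Proof.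
have sz v : size (g1_line v) = size v.
  elim/last_ind: v => [//|v j IH].
  by rewrite /g1_line -cats1 foldl_cat /= -/(g1_line _) /insert_at size_cat /=
             addnS -size_cat cat_take_drop IH cats1 size_rcons.
by rewrite {1}/g1_line -cats1 foldl_cat /= -/(g1_line _) sz.
Qed.

Lemma perm_insert_at k x s : perm_eq (insert_at k x s) (x :: s).
Proof. by rewrite /insert_at -cat1s perm_catCA /= cat_take_drop. Qed.

Lemma g1_line_perm w : perm_eq (g1_line w) (iota 1 (size w)).
Proof.
elim/last_ind: w => [//|w k IH]; rewrite g1_line_rcons size_rcons.
apply: perm_trans (perm_insert_at _ _ _) _.
by rewrite -addn1 iotaD /= add1n addn1 cats1 perm_sym perm_rcons perm_cons
           perm_sym.
Qed.

Lemma g1_ex n (w : word n) : exists s : 'S_n, oneline s == g1_line (letters w).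
Proof. by apply: oneline_ex; rewrite -{2}(size_letters w) g1_line_perm. Qed.

Lemma size_g2_place N w : size (g2_place N w) = size w.
Proof. by elim: w => //= k w ->. Qed.

Lemma g2_place_cons N k w :
  g2_place N (k :: w) = nth 0 (free N (g2_place N w)) k.-1 :: g2_place N w.
Proof. by []. Qed.

Lemma size_free N p :
  uniq p -> {subset p <= iota 1 N} -> size (free N p) = N - size p.
Proof.
move=> up sp; have uI := iota_uniq 1 N.
have /perm_size : perm_eq (p ++ free N p) (iota 1 N).
  apply: uniq_perm => // [|x].
    rewrite cat_uniq up filter_uniq // andbT.
    by apply/hasPn => x; rewrite mem_filter => /andP[].
  rewrite mem_cat mem_filter; case xp: (x \in p) => //=.
  by rewrite sp.
by rewrite size_cat size_iota => e; rewrite -[N in RHS]e addKn.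
Qed.

Lemma g2_place_inv N w : size w <= N ->
    (forall j, j < size w -> 0 < nth 0 w j <= (N - size w + j).+1) ->
  uniq (g2_place N w) /\ {subset g2_place N w <= iota 1 N}.
Proof.
elim: w => [//|k w IH] /= sw bw.
have [||up sp] := IH; first exact: ltnW.
  by move=> j jw; have := bw j.+1 jw; rewrite /= addnS -addSn subnSK.
have : nth 0 (free N (g2_place N w)) k.-1 \in free N (g2_place N w).
  apply: mem_nth; rewrite size_free // size_g2_place.
  by have /andP[k0] := bw 0 isT; rewrite prednK // addn0 subnSK.
rewrite mem_filter => /andP[np iN]; rewrite np up; split=> // x.
by rewrite inE => /predU1P[->|/sp].
Qed.

Lemma g2_line_perm n (w : word n) :
  perm_eq (g2_line (letters w)) (iota 1 n).
Proof.
have [||u s] := @g2_place_inv n (letters w); rewrite ?size_letters //.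
  by move=> j jn; rewrite subnn letters_bound.
rewrite /g2_line size_letters; apply: uniq_perm; rewrite ?iota_uniq //.
have [|_ //] := uniq_min_size u s.
by rewrite size_iota size_g2_place size_letters.
Qed.

Lemma g2_ex n (w : word n) : exists s : 'S_n, oneline s == g2_line (letters w).
Proof. exact/oneline_ex/g2_line_perm. Qed.

(* The permutations whose one-line notations are the words constructed above   *)
(* (unique by oneline_inj).                                                    *)
Definition g1 (n : nat) (w : word n) : 'S_n := xchoose (g1_ex w).
Definition g2 (n : nat) (w : word n) : 'S_n := xchoose (g2_ex w).

Lemma oneline_g1 n (w : word n) : oneline (g1 w) = g1_line (letters w).
Proof. exact/eqP/(xchooseP (g1_ex w)). Qed.

Lemma oneline_g2 n (w : word n) : oneline (g2 w) = g2_line (letters w).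
Proof. exact/eqP/(xchooseP (g2_ex w)). Qed.

Lemma card_word n : #|word n| = #|{: 'S_n}|.
Proof.
rewrite card_dep_ffun foldrE big_map big_enum /= -cardsT.
rewrite (_ : [set: 'S_n] = [set s | perm_on setT s]); last first.
  by apply/setP => s; rewrite !inE; apply/esym/subsetP => x _; rewrite inE.
rewrite cardsE card_perm cardsT card_ord fact_prod big_add1 big_mkord.
by apply: eq_bigr => i _; rewrite card_ord.
Qed.

Lemma index_insert_at k x s :
  x \notin s -> k.-1 <= size s -> index x (insert_at k x s) = k.-1.
Proof.
move=> xs ks; rewrite /insert_at index_cat /= eqxx addn0 size_takel //.
by case: ifP => // /mem_take; rewrite (negPf xs).
Qed.

Lemma rem_insert_at k x s : x \notin s -> rem x (insert_at k x s) = s.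
Proof.
move=> xs; rewrite /insert_at.
have : x \notin take k.-1 s by apply: contra xs => /mem_take.
move: (cat_take_drop k.-1 s); move: (take _ _) (drop _ _) => a b <-.
elim: a => [|y a IH] /=; first by rewrite eqxx.
by rewrite inE negb_or eq_sym => /andP[/negPf -> /IH ->].
Qed.

Lemma g1_line_inj w w' : size w = size w' ->
    (forall j, j < size w -> 0 < nth 0 w j <= j.+1) ->
    (forall j, j < size w' -> 0 < nth 0 w' j <= j.+1) ->
  g1_line w = g1_line w' -> w = w'.
Proof.
elim/last_ind: w w' => [|w k IH] w'; first by case: w'.
case/lastP: w' => [|w' k']; rewrite !size_rcons // => -[sz] bw bw'.
have nin v : (size v).+1 \notin g1_line v.
  by rewrite (perm_mem (g1_line_perm v)) mem_iota add1n ltnn andbF.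
have szg v : size (g1_line v) = size v.
  by rewrite (perm_size (g1_line_perm v)) size_iota.
rewrite !g1_line_rcons -sz => e.
have bk : 0 < k <= (size w).+1 by have := bw _ (leqnn _); rewrite nth_rcons ltnn eqxx.
have bk' : 0 < k' <= (size w).+1.
  by have := bw' _ (leqnn _); rewrite nth_rcons ltnn eqxx sz.
case/andP: bk bk' => k0 ks /andP[k0' ks'].
have nin' : (size w).+1 \notin g1_line w' by rewrite sz nin.
have ek : k = k'.
  have := congr1 (index (size w).+1) e.
  rewrite !index_insert_at ?nin ?szg -?sz -1?ltnS ?prednK //.
  by move=> ek; rewrite -(prednK k0) ek prednK.
have ew := congr1 (rem (size w).+1) e; rewrite !rem_insert_at // in ew.
rewrite ek (IH w') // => j jw.
  by have := bw j (ltnW jw); rewrite nth_rcons jw.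
by have := bw' j (ltnW jw); rewrite nth_rcons jw.
Qed.

Lemma g1_inj n : injective (@g1 n).
Proof.
move=> w w' e; apply/letters_inj/g1_line_inj; rewrite ?size_letters //.
- exact: letters_bound.
- exact: letters_bound.
- by rewrite -!oneline_g1 e.
Qed.

Lemma g2_place_inj N w w' : size w = size w' -> size w <= N ->
    (forall j, j < size w -> 0 < nth 0 w j <= (N - size w + j).+1) ->
    (forall j, j < size w' -> 0 < nth 0 w' j <= (N - size w' + j).+1) ->
  g2_place N w = g2_place N w' -> w = w'.
Proof.
elim: w w' => [|k w IH] [|k' w'] //= [sz] sw bw bw' [ek ew].
have b v v0 : size v < N ->
    (forall j, j < (size v).+1 ->
       0 < nth 0 (v0 :: v) j <= (N - (size v).+1 + j).+1) ->
    (forall j, j < size v -> 0 < nth 0 v j <= (N - size v + j).+1).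
  by move=> sv bv j jv; have := bv j.+1 jv; rewrite /= addnS -addSn subnSK.
have bv := b _ _ sw bw; rewrite sz in sw; have bv' := b _ _ sw bw'.
have ww := IH w' sz (ltnW _) bv bv' ew.
have {}ww : w = w' by apply: ww; rewrite sz.
subst w'; have [up sp] := g2_place_inv (ltnW sw) bv.
have /andP[k0 kN] := bw 0 isT; have /andP[k0' kN'] := bw' 0 isT.
rewrite /= addn0 subnSK // in k0 kN k0' kN'.
congr cons; move/eqP: ek; rewrite nth_uniq.
- by move/eqP => e; rewrite -(prednK k0) e prednK.
- by rewrite size_free // size_g2_place prednK.
- by rewrite size_free // size_g2_place prednK.
- by rewrite filter_uniq ?iota_uniq.
Qed.

Lemma g2_inj n : injective (@g2 n).
Proof.
move=> w w' e; apply/letters_inj/(@g2_place_inj n); rewrite ?size_letters //.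
- by move=> j jn; rewrite subnn letters_bound.
- by move=> j jn; rewrite subnn letters_bound.
- by have := congr1 (@oneline n) e; rewrite !oneline_g2 /g2_line !size_letters.
Qed.

Lemma g1_bij n : bijective (@g1 n).
Proof. by apply: inj_card_bij (@g1_inj n) _; rewrite card_word. Qed.

Lemma g2_bij n : bijective (@g2 n).
Proof. by apply: inj_card_bij (@g2_inj n) _; rewrite card_word. Qed.

Lemma g2_surj n (s : 'S_n) : exists w : word n, g2 w == s.
Proof. by have [h _ hK] := g2_bij n; exists (h s); rewrite hK. Qed.

Definition g2_inv (n : nat) (s : 'S_n) : word n := xchoose (g2_surj s).

Lemma g2_invK n : cancel (@g2_inv n) (@g2 n).
Proof. by move=> s; exact/eqP/(xchooseP (g2_surj s)). Qed.

Lemma g2K n : cancel (@g2 n) (@g2_inv n).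
Proof. by move=> w; apply: (@g2_inj n); rewrite g2_invK. Qed.

(* Main.v *)
Require Import Defs.
From mathcomp Require Import all_boot all_fingroup.
From mathcomp Require Import zify.

(** The two maps are inverse to each other pointwise: [g1 w = (g2 w)^-1] for
    every word [w].  Reading the recursion of [g1] backwards, the position of
    the largest value [n] in [g1 w] is the letter [w[n]]; erasing [n], the
    position of [n - 1] is the [w[n-1]]-th of the remaining positions, and so
    on.  This is the recipe that [g2] follows for entries instead of positions.
    Hence [g1 \o g2_inv] is the inversion [s |-> s^-1], whose fixed points are
    the involutions.

    The backward reading is turned into an induction on prefixes of [w]: a new
    last letter [k] acts on the word of positions of [g1] and on the word of
    entries of [g2] by the same operation, namely shifting the values [>= k] up
    by one (this is [bump k]) and appending [k].  See [positions_insert_at] and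
    [g2_place_rcons]. *)

(** The one-line notation of the inverse of the permutation with one-line
    notation [l]. *)
Definition positions (l : seq nat) : seq nat :=
  [seq (index x l).+1 | x <- iota 1 (size l)].

Lemma oneline_inv n (s : 'S_n) : oneline (s^-1)%g = positions (oneline s).
Proof.
rewrite /positions {2}/oneline size_map size_enum_ord (iotaDl 1 0).
rewrite -val_enum_ord -2!map_comp; apply: eq_map => i /=.
rewrite add1n -[in index _ _](permKV s i).
rewrite (index_map (f := fun j => (s j : nat).+1)) ?index_enum_ord //.
by move=> j j' [/val_inj/perm_inj].
Qed.

Lemma index_insert_at_neq k x y s :
  x != y -> k.-1 <= size s -> index x (insert_at k y s) = bump k.-1 (index x s).
Proof.
move=> xy ks; rewrite /insert_at -[in RHS](cat_take_drop k.-1 s) !index_cat /=.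
rewrite eq_sym (negPf xy); have sz := size_takel ks; case: ifP => [xa|_].
  by rewrite /bump leqNgt -[X in _ < X]sz index_mem xa.
by rewrite /bump sz leq_addr add1n addnS.
Qed.

(** Inserting the new maximum at position [k] pushes every entry from that
    position on one step to the right; the maximum, listed last among the values,
    contributes [k] itself. *)
Lemma positions_insert_at k s :
    0 < k <= (size s).+1 -> (size s).+1 \notin s ->
  positions (insert_at k (size s).+1 s) = rcons (map (bump k) (positions s)) k.
Proof.
case/andP=> k0 ks ns; have ks' : k.-1 <= size s by rewrite -ltnS prednK.
rewrite /positions (perm_size (perm_insert_at _ _ _)) [size (_ :: _)]/=.
rewrite -[X in iota _ X]addn1 iotaD map_cat cats1 /= add1n.
rewrite index_insert_at // prednK //.
congr rcons; rewrite -map_comp; apply/eq_in_map => x.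
rewrite mem_iota add1n => /andP[_ xs] /=.
rewrite index_insert_at_neq ?(ltn_eqF xs) //.
by rewrite -[in RHS](prednK k0) /bump ltnS addnS.
Qed.

Lemma iota_rem_bump N k : 0 < k <= N.+1 ->
  [seq x <- iota 1 N.+1 | x != k] = map (bump k) (iota 1 N).
Proof.
move=> /andP[k0 kN].
apply: (irr_sorted_eq ltn_trans ltnn).
- by rewrite sorted_filter ?iota_ltn_sorted //; apply: ltn_trans.
- rewrite sorted_map; apply: sub_sorted (iota_ltn_sorted 1 N) => x y xy.
  by rewrite /= ltn_neqAle leq_bump2 (can_eq (bumpK k)) -ltn_neqAle.
move=> x; rewrite mem_filter mem_iota; apply/andP/mapP.
  case=> xk /andP[x0 xN]; exists (unbump k x); last by rewrite unbumpKcond (negPf xk).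
  rewrite mem_iota /unbump; move: xk; rewrite neq_ltn.
  by case: (ltngtP k x) => //= kx _; rewrite ?subn0 ?subn1 /=; lia.
case=> y; rewrite mem_iota => /andP[y0 yN] ->; rewrite eq_sym neq_bump.
by split=> //; rewrite /bump; lia.
Qed.

(** Placing [k] last makes the entries still available an order-isomorphic copy,
    under [bump k], of those available in a set with one element less. *)
Lemma free_rcons_bump N k p : 0 < k <= N.+1 ->
  free N.+1 (rcons (map (bump k) p) k) = map (bump k) (free N p).
Proof.
move=> kN; rewrite /free.
under eq_filter => x do rewrite mem_rcons inE negb_or andbC.
rewrite filter_predI iota_rem_bump // filter_map; congr map.
by apply: eq_filter => x; rewrite /= mem_map //; apply: can_inj (bumpK k).
Qed.

Lemma g2_place_rcons N w k : 0 < k <= N.+1 ->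
  g2_place N.+1 (rcons w k) = rcons (map (bump k) (g2_place N w)) k.
Proof.
move=> kN; have /andP[k0 kN'] := kN.
elim: w => [|j w IH].
  rewrite /= /free (@eq_filter _ _ predT) // filter_predT.
  by rewrite nth_iota ?add1n prednK.
rewrite rcons_cons !g2_place_cons IH free_rcons_bump //=; congr cons.
(* The default value 0 of nth is fixed by bump k, since k is positive. *)
have {1}<- : bump k 0 = 0 by rewrite /bump leqNgt k0.
have [lt|ge] := ltnP j.-1 (size (free N (g2_place N w))).
  by rewrite (nth_map 0).
by rewrite !nth_default ?size_map.
Qed.

Lemma positions_g1_line w :
    (forall j, j < size w -> 0 < nth 0 w j <= j.+1) ->
  positions (g1_line w) = g2_line w.
Proof.
elim/last_ind: w => [//|w k IH] bw.
have sz : size (g1_line w) = size w.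
  by rewrite (perm_size (g1_line_perm w)) size_iota.
have bk : 0 < k <= (size w).+1.
  by have := bw (size w); rewrite size_rcons nth_rcons ltnn eqxx; apply.
rewrite g1_line_rcons /g2_line size_rcons g2_place_rcons // -sz.
rewrite positions_insert_at ?sz //.
  rewrite IH // => j jw.
  by have := bw j; rewrite size_rcons nth_rcons jw; apply; apply: ltnW.
by rewrite (perm_mem (g1_line_perm w)) mem_iota add1n ltnn andbF.
Qed.

Lemma g1_inv n (w : word n) : (g1 w)^-1%g = g2 w.
Proof.
apply: oneline_inj; rewrite oneline_inv oneline_g1 oneline_g2.
by apply: positions_g1_line => j; rewrite size_letters; apply: letters_bound.
Qed.

Theorem theorem5 (n : nat) (hn : 0 < n) (s : 'S_n) :
  (@g1 n \o @g2_inv n) s = s <-> (s^-1)%g = s.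
Proof. by rewrite /= -[g1 _]invgK g1_inv g2_invK. Qed.
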